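(* Let $D_n(t)=\sum_{\pi\in\mathfrak{D}_n}t^{\mathrm{des}(\pi)}=\sum_{k\geq1}d_{n,k}t^k$. Then for all $n\geq1$ and $1\leq k\leq n-1$, $$d_{2n,2n-k}< d_{2n,k}<d_{2n,2n-k-1}\quad\text{and}\quad d_{2n+1,k}< d_{2n+1,2n-k}< d_{2n+1,k+1},$$ except that $d_{4,1}=d_{4,2}=4$ (so the inequality $d_{4,1}<d_{4,2}$ does not hold). In particular, the polynomial $D_n(t)$ is unimodal for $n\geq2$.
   Context: $\mathfrak{D}_n$ is the set of derangements (fixed-point-free permutations) of $[n]=\{1,\dots,n\}$. For $\pi=\pi_1\cdots\pi_n$, $\mathrm{des}(\pi)=\#\{i\in[n-1]:\pi_i>\pi_{i+1}\}$. A polynomial $\sum h_it^i$ is unimodal if $h_0\le\cdots\le h_c\ge h_{c+1}\ge\cdots$ for some $c$. *)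

(* Defs.v *)
From mathcomp Require Import all_boot all_order all_algebra all_fingroup.
Set Implicit Arguments. Unset Strict Implicit. Unset Printing Implicit Defensive.
Import GRing.Theory.

(* Permutations of [n] are modelled as 'S_n, permutations of 'I_n = {0,..,n-1};
   the shift by one does not affect fixed points or descents. *)

Definition derangement (n : nat) (s : 'S_n) : bool := [forall i, s i != i].

Definition des (n : nat) (s : 'S_n) : nat :=
  #|[set i : 'I_n | [exists j : 'I_n, (val j == (val i).+1) && (s j < s i)]]|.

Definition dcoef (n k : nat) : nat :=
  #|[set s : 'S_n | derangement s && (des s == k)]|.

Definition Dpoly (n : nat) : {poly int} :=
  \sum_(s : 'S_n | derangement s) 'X^(des s).

Definition unimodal (p : {poly int}) : Prop :=
  exists c : nat,
    (forall i, (i < c)%N -> (p`_i <= p`_i.+1)%R) /\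
    (forall i, (c <= i)%N -> (p`_i.+1 <= p`_i)%R).

(* Main.v *)
(** Inserting a fixed point into a permutation of [n] with [j] fixed points and
    [k] descents keeps the number of descents in exactly [1 + j + k] of the [n+1]
    gaps, and increases it by one in the others; inserting the letter [n+1] keeps
    it in [1 + k] of them.  Hence both the polynomials [P n j] (descents over
    permutations with [j] fixed points) and their sum over [j] (the Eulerian
    polynomials) satisfy first order differential recurrences.  For fixed [i],
    the column [P (i+j) j] is thus determined by the derangement polynomial
    [P i 0], and comparing the two recurrences for all [i + j = n] forces
      d(n+1,k) = (k+1) d(n,k) + (n+1-k) d(n,k-1) + (-1)^(n+1) [k = n].
    With this recurrence, the inequalities d(n,l) < d(n,k) for k + l = n and
    d(n,k) < d(n,l) for k + l = n - 1, where 0 < k < l, are proved together by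
    induction on [n], without distinguishing the parity of [n]. *)
Require Import Defs.
From mathcomp Require Import all_boot all_order all_algebra all_fingroup.
From mathcomp Require Import zify ring.
Set Implicit Arguments. Unset Strict Implicit. Unset Printing Implicit Defensive.
Import Order.TTheory GRing.Theory Num.Theory.

(** * Inserting a letter into a permutation, and its effect on descents *)

Lemma lift_perm_surj n (i : 'I_n.+1) (s : 'S_n.+1) :
  exists t : 'S_n, s = lift_perm i (s i) t.
Proof.
have ex k : {l | s (lift i k) = lift (s i) l}.
  have: s i != s (lift i k) by rewrite (inj_eq perm_inj) neq_lift.
  by case/unlift_some=> l -> _; exists l.
have inj : injective (fun k => sval (ex k)).
  move=> k l /(congr1 (lift (s i))).
  by rewrite -(svalP (ex k)) -(svalP (ex l)) => /perm_inj/lift_inj.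
exists (perm inj); apply/permP=> k.
case: (unliftP i k) => [l|] ->; last by rewrite lift_perm_id.
by rewrite lift_perm_lift permE -(svalP (ex l)).
Qed.

Lemma lift_perm_inj n (i j : 'I_n.+1) : injective (@lift_perm n i j).
Proof.
move=> s t /permP est; apply/permP=> k; apply: (@lift_inj _ j).
by have := est (lift i k); rewrite !lift_perm_lift.
Qed.

Lemma sum_lift_perm (V : nmodType) n (i j : 'I_n.+1) (P : pred 'S_n.+1)
    (F : 'S_n.+1 -> V) :
  (\sum_(s : 'S_n.+1 | (s i == j) && P s) F s =
   \sum_(s : 'S_n | P (lift_perm i j s)) F (lift_perm i j s))%R.
Proof.
rewrite -(big_imset F (h := @lift_perm n i j)) /=; last first.
  by move=> s t _ _; apply: lift_perm_inj.
apply: eq_bigl => s; apply/andP/imsetP => [[/eqP sij Ps]|[t Pt ->]].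
  by have [t] := lift_perm_surj i s; rewrite sij => st; exists t; rewrite // unfold_in -st.
by rewrite lift_perm_id eqxx.
Qed.

(* Setting [word s n = n] makes the last position a non-descent, so that the
   n.+1 gaps of [s] are treated uniformly. *)
Definition word n (s : 'S_n) (i : nat) : nat :=
  if insub i is Some i' then s i' : nat else n.

Definition ndes (w : nat -> nat) n : nat := \sum_(k < n) (w k.+1 < w k).

Lemma word_ord n (s : 'S_n) (i : 'I_n) : word s i = s i.
Proof. by rewrite /word valK. Qed.

Lemma word_out n (s : 'S_n) i : n <= i -> word s i = n.
Proof. by move=> ni; rewrite /word insubF // ltnNge ni. Qed.

Lemma word_lt n (s : 'S_n) i : i < n -> word s i < n.
Proof. by move=> lt_in; rewrite -[i]/(val (Ordinal lt_in)) word_ord. Qed.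

Lemma word_le n (s : 'S_n) i : word s i <= n.
Proof. by case: (leqP n i) => [/word_out-> //|/(word_lt s)/ltnW]. Qed.

Lemma word_inj n (s : 'S_n) i k : i < n -> k < n -> word s i = word s k -> i = k.
Proof.
move=> lt_in lt_kn.
rewrite -[i]/(val (Ordinal lt_in)) -[k]/(val (Ordinal lt_kn)) !word_ord.
by move/val_inj/perm_inj=> ->.
Qed.

Lemma desE n (s : 'S_n) : des s = ndes (word s) n.
Proof.
rewrite /des -sum1_card big_mkcond /=; apply: eq_bigr => i _.
rewrite inE word_ord; have [lt_in|] := ltnP i.+1 n.
  rewrite -[i.+1]/(val (Ordinal lt_in)) word_ord.
  case: existsP => [[j /andP[/eqP ij lt_s]]|nex].
    by rewrite (_ : Ordinal lt_in = j) ?lt_s //; apply: val_inj.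
  case: ltnP => // lt_s; case: nex; exists (Ordinal lt_in).
  by rewrite eqxx.
move=> le_ni; rewrite word_out //.
rewrite [n < _]ltnNge ltnW //=; case: existsP => // -[j /andP[/eqP ij _]].
by have := ltn_ord j; rewrite ij ltnNge le_ni.
Qed.

Lemma ndesD w a b : ndes w (a + b) = ndes w a + ndes (fun k => w (a + k)) b.
Proof.
rewrite /ndes big_split_ord /=; congr (_ + _).
by apply: eq_bigr => k _; rewrite addnS.
Qed.

Lemma eq_ndes w1 w2 n :
  (forall k, k <= n -> w1 k = w2 k) -> ndes w1 n = ndes w2 n.
Proof. by move=> eqw; apply: eq_bigr => k _; rewrite !eqw // ltnW. Qed.

Lemma ltn_bump j a b : (bump j a < bump j b) = (a < b).
Proof. by rewrite /bump; do 2 case: leqP => ? //=; lia. Qed.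

Lemma ndes_bump j w n : ndes (bump j \o w) n = ndes w n.
Proof. by apply: eq_bigr => k _ /=; rewrite ltn_bump. Qed.

Lemma word_lift_perm n (i j : 'I_n.+1) (s : 'S_n) k :
  word (lift_perm i j s) k =
    if k == i then j : nat else bump j (word s (unbump i k)).
Proof.
have := ltn_ord j; rewrite ltnS => le_jn.
have [lt_kn|le_nk] := ltnP k n.+1; last first.
  rewrite word_out // word_out ?/bump ?le_jn.
    by case: eqP => // ki; have := ltn_ord i; rewrite -ki ltnNge le_nk.
  by have := ltn_ord i; rewrite /unbump; lia.
rewrite -[k]/(val (Ordinal lt_kn)) word_ord.
case: (unliftP i (Ordinal lt_kn)) => [l|] ->.
  by rewrite lift_perm_lift /= bumpK word_ord /= [_ == nat_of_ord i]eq_sym (negPf (neq_bump _ _)).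
by rewrite lift_perm_id eqxx.
Qed.

(* Inserting the value [j] in gap [i] removes the possible descent across the
   gap and creates one on each side according to the neighbours of [j]. *)
Lemma des_lift_perm n (i j : 'I_n.+1) (s : 'S_n) :
  des (lift_perm i j s) + ((0 < i) && (word s i < word s i.-1)) =
    des s + ((0 < i) && (j <= word s i.-1)) + (word s i < j).
Proof.
have := ltn_ord i; rewrite !desE ltnS.
set w := word s; have wE := word_lift_perm i j s.
have bj a : (bump j a < j) = (a < j) by rewrite /bump; case: leqP => ? /=; lia.
have jb a : (j < bump j a) = (j <= a) by rewrite /bump; case: leqP => ? /=; lia.
have: forall k, word (lift_perm i j s) k =
  if k < i then bump j (w k) else if k == i then j : nat else bump j (w k.-1).
  by move=> k; rewrite wE /unbump; case: ltngtP => //; rewrite ?subn0 ?subn1.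
move: bj jb; move: (word _) => w'.
move: (nat_of_ord i) (nat_of_ord j) => {wE i j} [|a] j bj jb wE le_an /=.
  rewrite addn0 addn0 -(add1n n) ndesD addnC; congr (_ + _).
    by rewrite -(ndes_bump j w); apply: eq_ndes => k _ /=; rewrite wE.
  by rewrite /ndes big_ord1 !wE /= bj.
have splitn f m : ndes f (a + m.+1) =
    ndes f a + (f a.+1 < f a) + ndes (fun k => f (a.+1 + k)) m.
  rewrite -add1n addnA ndesD addn1; congr (_ + _).
  by rewrite -addn1 ndesD /ndes big_ord1 addn0 addn1.
have [m ->] : exists m, n = a + m.+1 by exists (n - a.+1); lia.
(* The new letter turns the one comparison across the gap into two; those before and after the gap
   agree up to [bump j]. *)
rewrite -addnS (splitn w') (splitn w) -(add1n m) ndesD [ndes _ 1]/ndes big_ord1.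
have -> : ndes w' a = ndes w a.
  rewrite -(ndes_bump j w); apply: eq_ndes => k le_ka.
  by rewrite wE ltnS le_ka.
have -> : ndes (fun k => w' (a.+1 + (1 + k))) m = ndes (fun k => w (a.+1 + k)) m.
  rewrite -(ndes_bump j (fun k => w (a.+1 + k))); apply: eq_ndes => k _ /=.
  by rewrite wE; do 2![case: ifP => ?; first lia]; congr (bump _ (w _)); lia.
rewrite addn0 addn1 !wE ltnSn eqxx !ltnn [a.+2 < _]ltnNge leqnSn /=.
have -> : (a.+2 == a.+1) = false by lia.
rewrite bj jb; lia.
Qed.

(** Each descent of [s] is broken by insertion in exactly one gap, which accounts for the [des s] on
    the left. *)
Lemma sum_des_lift_perm n (f : 'I_n.+1 -> 'I_n.+1) (s : 'S_n) :
  \sum_(i < n.+1) des (lift_perm i (f i) s) + des s =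
    n.+1 * des s + \sum_(i < n) (f (lift ord0 i) <= s i)
      + \sum_(i < n.+1) (word s i < f i).
Proof.
have -> : \sum_(i < n) (f (lift ord0 i) <= s i) =
    \sum_(i < n.+1) ((0 < i) && (f i <= word s i.-1)).
  by rewrite big_ord_recl /= add0n; apply: eq_bigr => i _; rewrite word_ord.
have -> : \sum_(i < n.+1) des (lift_perm i (f i) s) + des s =
    \sum_(i < n.+1) (des (lift_perm i (f i) s) +
                     ((0 < i) && (word s i < word s i.-1))).
  rewrite big_split; congr (_ + _); rewrite desE big_ord_recl /= add0n.
  by apply: eq_bigr.
rewrite (eq_bigr _ (fun i _ => des_lift_perm i (f i) s)) !big_split /=.
by rewrite sum_nat_const card_ord.
Qed.

(** * Fixed points, and descents totalled over all insertions *)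

Definition nfix n (s : 'S_n) : nat := #|[set i | s i == i]|.

Lemma nfixE n (s : 'S_n) : nfix s = \sum_(i < n) (s i == i).
Proof.
by rewrite /nfix -sum1_card big_mkcond; apply: eq_bigr => i _; rewrite inE; case: eqP.
Qed.

Lemma nfix_lift_perm n (i : 'I_n.+1) (s : 'S_n) :
  nfix (lift_perm i i s) = (nfix s).+1.
Proof.
rewrite !nfixE (bigD1_ord i) //= lift_perm_id eqxx add1n; congr _.+1.
by apply: eq_bigr => k _; rewrite lift_perm_lift (inj_eq lift_inj).
Qed.

Lemma nfix_eq0 n (s : 'S_n) : (nfix s == 0) = derangement s.
Proof.
rewrite /nfix cards_eq0; apply/eqP/forallP => [s0 i|ds].
  by have /setP/(_ i) := s0; rewrite !inE => ->.
by apply/setP=> i; rewrite !inE (negPf (ds i)).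
Qed.

Lemma sum_des_lift_perm_max n (s : 'S_n) :
  \sum_(i < n.+1) des (lift_perm i ord_max s) + des s = n.+1 * des s + n.
Proof.
rewrite (sum_des_lift_perm (fun=> ord_max)) big1 ?addn0 => [|i _]; last first.
  by rewrite leqNgt ltn_ord.
rewrite big_ord_recr /= word_out // ltnn addn0; congr (_ + _).
rewrite (eq_bigr (fun=> 1)) ?sum_nat_const ?card_ord ?muln1 // => i _.
by rewrite word_lt.
Qed.

Lemma sum_des_lift_perm_id n (s : 'S_n) :
  \sum_(i < n.+1) des (lift_perm i i s) + des s + nfix s = n.+1 * des s + n.
Proof.
rewrite (sum_des_lift_perm id) big_ord_recr /= word_out // ltnn addn0 nfixE.
rewrite -!addnA -!big_split /=; congr (_ + _).
rewrite (eq_bigr (fun=> 1)) ?sum_nat_const ?card_ord ?muln1 // => i _.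
by rewrite /bump /= word_ord -val_eqE /=; case: ltngtP.
Qed.

Lemma des_lift_perm_max n (i : 'I_n.+1) (s : 'S_n) :
  des s <= des (lift_perm i ord_max s) <= (des s).+1.
Proof.
have := des_lift_perm i ord_max s; have /= := ltn_ord i; rewrite ltnS => le_in.
have := word_le s i.-1; have : 0 < i -> word s i.-1 < n.
  by move=> i0; apply: word_lt; lia.
lia.
Qed.

Lemma des_lift_perm_id n (i : 'I_n.+1) (s : 'S_n) :
  des s <= des (lift_perm i i s) <= (des s).+1.
Proof.
have := des_lift_perm i i s.
have : 0 < i -> i < n -> word s i <> word s i.-1.
  by move=> i0 lt_in /word_inj; lia.
have := ltn_ord i; have : i = n :> nat -> word s i = n by move=> ->; rewrite word_out.
lia.
Qed.

(** * Differential recurrences for descent polynomials *)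

Local Open Scope ring_scope.

(** The Eulerian recurrence: ['X^d] goes to [(1 + d) 'X^d + (n - d) 'X^(d+1)]. *)
Definition eulerian_op n (p : {poly int}) : {poly int} :=
  (1 + n%:R * 'X) * p + 'X * (1 - 'X) * p^`().

(** Only the exponents [d] and [d.+1] occur, so their total fixes how often each does: [1 + d + m]
    and [n - d - m] times. *)
Lemma sum_gaps n (e : 'I_n.+1 -> nat) d m :
    (forall i, d <= e i <= d.+1)%N ->
    (\sum_i e i + d + m = n.+1 * d + n)%N ->
  \sum_i 'X^(e i) = eulerian_op n 'X^d + m%:R * (1 - 'X) * 'X^d.
Proof.
move=> e_bounds e_sum.
have Xe i : 'X^(e i) = 'X^d + ((e i)%:R - d%:R) * ('X^(d.+1) - 'X^d) :> {poly int}.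
  have /andP[] := e_bounds i; rewrite leq_eqVlt => /predU1P[<- _|lt_de le_ed].
    by rewrite subrr mul0r addr0.
  have -> : e i = d.+1 by lia.
  by rewrite -natrB // subSnn mul1r addrC subrK.
rewrite (eq_bigr _ (fun i _ => Xe i)) big_split /= -mulr_suml sumrB.
rewrite !sumr_const card_ord -natr_sum.
have -> : (\sum_i e i)%:R = (n.+1 * d + n)%:R - d%:R - m%:R :> {poly int}.
  by rewrite -e_sum !natrD; ring.
have XdX : 'X * (1 - 'X) * ('X^d)^`() = d%:R * (1 - 'X) * 'X^d :> {poly int}.
  rewrite derivXn -[_ *+ d]mulr_natl.
  by case: d {e_bounds e_sum Xe} => [|d]; rewrite /= ?mul0r ?mulr0 // exprS; ring.
rewrite /eulerian_op XdX exprS -[d%:R *+ _]mulr_natl -[_ *+ n.+1]mulr_natl.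
rewrite natrD natrM; ring.
Qed.

Lemma eulerian_op_sum n (I : Type) (r : seq I) (P : pred I) (F : I -> {poly int}) :
  eulerian_op n (\sum_(i <- r | P i) F i) = \sum_(i <- r | P i) eulerian_op n (F i).
Proof. by rewrite /eulerian_op raddf_sum !mulr_sumr -big_split. Qed.

Definition des_poly n j : {poly int} := \sum_(s : 'S_n | nfix s == j) 'X^(des s).

Definition des_poly_all n : {poly int} := \sum_(s : 'S_n) 'X^(des s).

(** Classify by the position of the largest letter and delete it. *)
Lemma des_poly_allS n : des_poly_all n.+1 = eulerian_op n (des_poly_all n).
Proof.
rewrite eulerian_op_sum /des_poly_all.
rewrite (partition_big (fun s : 'S_n.+1 => s^-1%g ord_max) predT) //=.
under eq_bigr => i _ do under eq_bigl => s do
  rewrite -(inj_eq (perm_inj (s := s))) permKV eq_sym -[_ == _]andbT.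
under eq_bigr => i _ do rewrite sum_lift_perm.
rewrite exchange_big /=; apply: eq_bigr => s _.
transitivity (eulerian_op n 'X^(des s) + 0%:R * (1 - 'X) * 'X^(des s)).
  apply: sum_gaps => [i|]; first exact: des_lift_perm_max.
  by rewrite addn0 sum_des_lift_perm_max.
by rewrite !mul0r addr0.
Qed.

(** Double counting of permutations with a marked fixed point: deleting the marked one of [j.+1]
    fixed points leaves [j]. *)
Lemma des_polyS n j :
  j.+1%:R * des_poly n.+1 j.+1 =
    eulerian_op n (des_poly n j) + j%:R * (1 - 'X) * des_poly n j.
Proof.
rewrite eulerian_op_sum [X in _ + X]mulr_sumr -big_split /=.
transitivity (\sum_(s : 'S_n.+1 | nfix s == j.+1) \sum_(i | s i == i)
               ('X^(des s) : {poly int})).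
  rewrite mulr_sumr; apply: eq_bigr => s /eqP <-.
  by rewrite sumr_const mulr_natl /nfix cardsE.
rewrite (exchange_big_dep predT) //=.
under eq_bigr => i _ do under eq_bigl => s do rewrite andbC.
under eq_bigr => i _ do rewrite sum_lift_perm
  (eq_bigl _ _ (fun s => congr1 (fun x => x == j.+1) (nfix_lift_perm i s))).
rewrite exchange_big /=; apply: eq_bigr => s /eqP[<-].
apply: sum_gaps => [i|]; first exact: des_lift_perm_id.
exact: sum_des_lift_perm_id.
Qed.

Lemma nfix_le n (s : 'S_n) : (nfix s <= n)%N.
Proof. by rewrite -[n in leqRHS]card_ord max_card. Qed.

Lemma des_poly_sum n : \sum_(j < n.+1) des_poly n j = des_poly_all n.
Proof.
rewrite /des_poly_all (partition_big (fun s => inord (nfix s) : 'I_n.+1) predT) //=.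
apply: eq_bigr => j _; apply: eq_bigl => s.
by rewrite -val_eqE /= inordK // ltnS nfix_le.
Qed.

Lemma eulerian_opB n p q : eulerian_op n (p - q) = eulerian_op n p - eulerian_op n q.
Proof. rewrite /eulerian_op derivB; ring. Qed.

Lemma eulerian_opD n p q : eulerian_op n (p + q) = eulerian_op n p + eulerian_op n q.
Proof. rewrite /eulerian_op derivD; ring. Qed.

Lemma deriv_natr n : (n%:R : {poly int})^`() = 0.
Proof. by rewrite -polyC_natr derivC. Qed.

Lemma eulerian_op_natM n m p : eulerian_op n (m%:R * p) = m%:R * eulerian_op n p.
Proof. rewrite /eulerian_op derivM deriv_natr; ring. Qed.

Lemma eulerian_opXB n m p :
  eulerian_op n.+1 (m%:R * (1 - 'X) * p) = m%:R * (1 - 'X) * eulerian_op n p.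
Proof. rewrite /eulerian_op !derivM derivB derivX derivC deriv_natr; ring. Qed.

Lemma mul_natS_inj n : injective (fun p : {poly int} => n.+1%:R * p).
Proof. by apply: mulfI; rewrite -polyC_natr polyC_eq0 pnatr_eq0. Qed.

(** The value 1 propagates because [(1 + n 'X) + n (1 - 'X) = n + 1]. *)
Lemma des_poly_diag n : des_poly n n = 1.
Proof.
elim: n => [|n IHn].
  have no_pos (s : 'S_0) (P : pred 'I_0) : #|P| = 0%N by apply: eq_card0 => -[].
  rewrite /des_poly (eq_bigr (fun=> 1)) => [|s _]; last first.
    by rewrite /des no_pos // expr0.
  rewrite sumr_const (_ : #|_| = 1%N) // -[RHS](card_Sn 0); apply: eq_card => s.
  by rewrite !unfold_in /= /nfix no_pos.
apply: (@mul_natS_inj n); rewrite des_polyS IHn /eulerian_op derivC; ring.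
Qed.

(* Up to sign, the descent polynomial of the standard Young tableaux of hook
   shape (n+1-i, 1^i). *)
Definition hook_poly n i : {poly int} := (-1) ^+ i * ('C(n, i)%:R * 'X^i).

Lemma hook_polyS i j :
  let hook_diff n := hook_poly n i.+1 - hook_poly n i in
  j.+1%:R * hook_diff (i + j).+1 =
    eulerian_op (i + j).+1 (hook_diff (i + j)%N) + j%:R * (1 - 'X) * hook_diff (i + j)%N.
Proof.
rewrite /= /hook_poly.
have bin1 : i.+1%:R * 'C(i + j, i.+1)%:R = j%:R * 'C(i + j, i)%:R :> {poly int}.
  by rewrite -!natrM mul_bin_left addKn.
have bin2 : j.+1%:R * 'C((i + j).+1, i)%:R = (i + j).+1%:R * 'C(i + j, i)%:R :> {poly int}.
  by rewrite -!natrM mul_bin_down -addnS addKn.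
have opX d c k : eulerian_op (i + j).+1 ((-1) ^+ k * (c%:R * 'X^d)) =
    (-1) ^+ k * (c%:R * ((1 + d%:R) * 'X^d + ((i + j).+1%:R - d%:R) * 'X^(d.+1))).
  have -> : (-1) ^+ k = ((-1) ^+ k : int)%:P by rewrite polyC_exp polyCN.
  rewrite /eulerian_op !derivM derivC deriv_natr derivXn -mulr_natl exprS.
  by case: d => [|d] /=; rewrite ?exprS; ring.
rewrite eulerian_opB !opX binS !exprS.
(* A vanishing combination of [bin1] and [bin2]; adding it to the right side leaves an identity for
   [ring]. *)
have zero : 0 = (-1) ^+ i * 'X^i *
    ('X * (i.+1%:R * 'C(i + j, i.+1)%:R - j%:R * 'C(i + j, i)%:R)
     - (j.+1%:R * 'C((i + j).+1, i)%:R - (i + j).+1%:R * 'C(i + j, i)%:R)) :> {poly int}.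
  by rewrite bin1 bin2 !subrr; ring.
rewrite -[RHS]addr0 zero natrD; ring.
Qed.

(* The error term [err i j] satisfies the same recurrence in [j] as the
   polynomials [des_poly (i + j) j], so it vanishes as soon as [err i 0] does; and
   the sum of [err i j] over [i + j = n] telescopes to zero. *)
Lemma des_poly_recurrence n i j : i + j = n ->
  des_poly n.+1 j = eulerian_op n (des_poly n j) + (hook_poly n i.+1 - hook_poly n i).
Proof.
pose err i j := des_poly (i + j).+1 j - eulerian_op (i + j) (des_poly (i + j) j)
  - (hook_poly (i + j) i.+1 - hook_poly (i + j) i).
suff err0 : err i j = 0.
  by move=> <-; apply/eqP; rewrite -subr_eq0 opprD addrA -/(err i j) err0.
have errS a b : b.+1%:R * err a b.+1 =
    eulerian_op (a + b).+1 (err a b) + b%:R * (1 - 'X) * err a b.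
  have /= hook_eq := hook_polyS a b.
  rewrite /err addnS 2!mulrBr hook_eq des_polyS -eulerian_op_natM des_polyS.
  rewrite !eulerian_opB eulerian_opD eulerian_opXB.
  ring.
have err_col a b : err a 0 = 0 -> err a b = 0.
  move=> err_a0; elim: b => // b IHb; apply: (@mul_natS_inj b).
  by rewrite errS IHb /eulerian_op deriv0; ring.
(* Strong induction on the first index, now called [n]: the earlier columns vanish, so the
   antidiagonal sum reduces to [err n 0]. *)
apply/err_col; elim/ltn_ind: i {j n} => n IHn.
have sum_err : \sum_(i < n.+1) err i (n - i)%N = 0.
  transitivity ((\sum_(j < n.+1) des_poly n.+1 j) - eulerian_op n (des_poly_all n)
                - \sum_(0 <= i < n.+1) (hook_poly n i.+1 - hook_poly n i)).
    rewrite -des_poly_sum eulerian_op_sum big_mkord.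
    rewrite [X in _ - X](reindex_inj rev_ord_inj) [LHS](reindex_inj rev_ord_inj) /=.
    rewrite -!sumrB; apply: eq_bigr => j _.
    by rewrite /err subSS subKn ?subnK // -ltnS.
  (* The missing term [j = n.+1] of the first sum contributes -1, and the hook polynomials telescope
     to [hook_poly n n.+1 - hook_poly n 0 = -1]. *)
  rewrite -des_poly_allS -des_poly_sum [X in _ - X - _]big_ord_recr /= des_poly_diag.
  rewrite telescope_sumr // /hook_poly bin_small // bin0; ring.
rewrite big_ord_recr /= subnn big1 ?add0r // in sum_err => i _.
exact/err_col/IHn.
Qed.

(** * Recurrence and boundary values for the coefficients *)

Lemma Dpoly_des_poly n : Dpoly n = des_poly n 0.
Proof. by apply: eq_bigl => s; rewrite nfix_eq0. Qed.

Lemma DpolyS n : Dpoly n.+1 = eulerian_op n (Dpoly n) + (-1) ^+ n.+1 * 'X^n.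
Proof.
rewrite !Dpoly_des_poly (des_poly_recurrence (addn0 n)).
by rewrite /hook_poly binn bin_small // exprS; ring.
Qed.

Lemma coef_Dpoly n k : (Dpoly n)`_k = (dcoef n k)%:Z.
Proof.
rewrite /Dpoly coef_sum /dcoef -sum1_card -[RHS]natz natr_sum.
under [RHS]eq_bigl => s do rewrite inE.
rewrite big_mkcondr; apply: eq_bigr => s _; rewrite coefXn eq_sym; case: eqP => //.
Qed.

Lemma coef_eulerian_op n (p : {poly int}) k :
  (eulerian_op n p)`_k.+1 = k.+2%:Z * p`_k.+1 + (n%:Z - k%:Z) * p`_k.
Proof.
have -> : eulerian_op n p = p + n%:R *: ('X * p) + 'X * (p^`() - 'X * p^`()).
  by rewrite /eulerian_op scaler_nat; ring.
rewrite !coefD coefZ !coefXM /= coefB coefXM !coef_deriv.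
case: k => [|k] /=; ring.
Qed.

Lemma coef0_eulerian_op n (p : {poly int}) : (eulerian_op n p)`_0 = p`_0.
Proof.
rewrite /eulerian_op mulrDl mul1r -!mulrA !coefD coefXM /= addr0.
by rewrite mulr_natl coefMn coefXM /= mul0rn addr0.
Qed.

Lemma dcoefS n k :
  (dcoef n.+1 k.+1)%:Z = k.+2%:Z * (dcoef n k.+1)%:Z
    + (n%:Z - k%:Z) * (dcoef n k)%:Z + (-1) ^+ n.+1 * (k.+1 == n)%:Z.
Proof.
rewrite -!coef_Dpoly DpolyS coefD coef_eulerian_op; congr (_ + _).
rewrite -signr_odd -[in RHS]signr_odd !mulr_sign.
by case: odd; rewrite ?coefN coefXn; case: eqP.
Qed.

Lemma dcoef0 k : dcoef 0 k = (k == 0%N).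
Proof.
have := coef_Dpoly 0 k; rewrite Dpoly_des_poly des_poly_diag coef1.
by case: eqP => _ /= [].
Qed.

Lemma dcoefS0 n : dcoef n.+1 0 = 0%N.
Proof.
have dS m : (dcoef m.+1 0)%:Z = (dcoef m 0)%:Z + (-1) ^+ m.+1 * (0 == m)%N%:Z.
  rewrite -!coef_Dpoly DpolyS coefD coef0_eulerian_op; congr (_ + _).
  rewrite -signr_odd -[in RHS]signr_odd !mulr_sign.
  by case: odd; rewrite ?coefN coefXn; case: eqP.
have := dcoef0 0.
move=> d0; elim: n => [|n IHn]; [have := dS 0%N | have := dS n.+1]; rewrite /= ?expr1; lia.
Qed.

Lemma dcoef_oversize n k : (n <= k)%N -> dcoef n.+1 k.+1 = 0%N.
Proof.
elim: n k => [|n IHn] k le_nk.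
  by have := dcoefS 0 k; rewrite !dcoef0; case: k {le_nk} => [|k] /=; lia.
case: k le_nk => // k le_nk; have := dcoefS n.+1 k.+1.
rewrite IHn ?IHn //; last exact: leqW.
have -> : (k.+2 == n.+1) = false by lia.
lia.
Qed.

(** Only the decreasing permutation has [n] descents, and it has no fixed point exactly for odd [n].
    In the induction the sign term flips the parity. *)
Lemma dcoef_top n : dcoef n.+1 n = odd n.
Proof.
elim: n => [|n IHn]; first exact: dcoefS0.
have := dcoefS n.+1 n; rewrite (dcoef_oversize (leqnn n)) IHn eqxx -signr_odd /=.
by case: odd => /=; lia.
Qed.

Lemma dcoef1_gt0 n : (0 < dcoef n.+2 1)%N.
Proof.
elim: n => [|n IHn]; first by rewrite dcoef_top.
by have := dcoefS n.+2 0; rewrite dcoefS0; lia.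
Qed.

(** * Inequalities between mirrored coefficients, and unimodality *)

Definition mirror_lt n := forall k l, (k + l = n)%N ->
  (0 < k < l)%N -> (dcoef n l < dcoef n k)%N.

(** The boolean [n != 4] counts as 0 or 1: the inequality is strict except in row 4, where it is
    weak. *)
Definition comirror_lt n := forall k l, (k + l).+1 = n ->
  (0 < k < l)%N -> (dcoef n k + (n != 4) <= dcoef n l)%N.

Lemma mirror_le n k l : mirror_lt n.+1 -> (k + l = n.+1)%N -> (k <= l)%N ->
  (dcoef n.+1 l <= dcoef n.+1 k)%N.
Proof.
move=> lt_n kl; rewrite leq_eqVlt => /predU1P[-> //|lt_kl].
case: k => [|k] in kl lt_kl *; last by apply/ltnW/lt_n.
by rewrite add0n in kl; rewrite kl dcoef_oversize.
Qed.

Lemma comirror_le n k l : comirror_lt n.+1 -> (k + l = n)%N -> (k <= l)%N ->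
  (dcoef n.+1 k <= dcoef n.+1 l)%N.
Proof.
move=> lt_n kl; rewrite leq_eqVlt => /predU1P[-> //|lt_kl].
case: k => [|k] in kl lt_kl *; first by rewrite dcoefS0.
by have := lt_n _ _ (congr1 succn kl) lt_kl; lia.
Qed.

(** Write [d] for row [n.+1] and let [k + l = n]. For [k > 0], entry [k+1] minus entry [l+1] of the
    next row is [(k+1)(d(k+1) - d(l)) + (l+1)(d(k) - d(l+1)) + (d(k+1) - d(l+1))], whose last
    bracket is positive. *)
Lemma mirror_ltS n : mirror_lt n.+1 -> comirror_lt n.+1 -> mirror_lt n.+2.
Proof.
move=> lo hi [|k] [|l] //= kl lt_kl; have {}kl : n = (k + l)%N by lia.
have lo1 : (dcoef n.+1 l <= dcoef n.+1 k.+1)%N by apply: mirror_le => //; lia.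
have lo2 : (dcoef n.+1 l.+1 <= dcoef n.+1 k)%N by apply: mirror_le => //; lia.
have hi1 : (dcoef n.+1 k <= dcoef n.+1 l)%N by apply: comirror_le => //; lia.
have := dcoefS n.+1 k; have := dcoefS n.+1 l.
have -> : (k.+1 == n.+1) = false by lia.
case: k => [|k] in kl lt_kl lo1 lo2 hi1 *.
  (* Here the sign term enters, but entry [n.+1] of the new row is at most 1 while entry 1 is at
     least 2. *)
  rewrite add0n in kl; subst l; rewrite eqxx -signr_odd /=.
  have := dcoefS0 n; have := dcoef_top n; have := dcoef_oversize (leqnn n).
  case: n => [|[|n]] // in lo hi lo1 lo2 hi1 lt_kl *; first by move=> /=; lia.
  by have := dcoef1_gt0 n.+1; have := @lo 1%N n.+2 erefl isT; case: odd => /=; lia.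
have lo3 : (dcoef n.+1 l.+1 < dcoef n.+1 k.+1)%N by apply: lo; lia.
have -> : (l.+1 == n.+1) = false by lia.
have -> : n.+1%:Z - k.+1%:Z = l.+1 by lia.
have -> : n.+1%:Z - l%:Z = k.+2 by lia.
rewrite !mulr0 !addr0; nia.
Qed.

(** With [k + l + 1 = n], entry [l+1] minus entry [k+1] of the new row is [(l+2)(d(l+1) - d(k)) +
    (k+2)(d(l) - d(k+1))]; one positive bracket suffices for strictness. *)
Lemma comirror_ltS n : mirror_lt n.+1 -> comirror_lt n.+1 -> comirror_lt n.+2.
Proof.
move=> lo hi [|k] [|l] //= kl lt_kl; have {}kl : n = (k + l).+1 by lia.
have lo1 : (dcoef n.+1 k <= dcoef n.+1 l.+1)%N by apply: comirror_le => //; lia.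
have lo2 : (dcoef n.+1 k.+1 <= dcoef n.+1 l)%N by apply: comirror_le => //; lia.
have := dcoefS n.+1 k; have := dcoefS n.+1 l.
have -> : (k.+1 == n.+1) = false by lia.
have -> : (l.+1 == n.+1) = false by lia.
have -> : n.+1%:Z - k%:Z = l.+2 by lia.
have -> : n.+1%:Z - l%:Z = k.+2 by lia.
rewrite !mulr0 !addr0.
have [n2|n2] := eqVneq n.+2 4%N; first nia.
suff : (dcoef n.+1 k < dcoef n.+1 l.+1)%N || (dcoef n.+1 k.+1 < dcoef n.+1 l)%N.
  by case/orP=> lt_d; nia.
case: k => [|k] in kl lt_kl lo1 lo2 *; last first.
  by apply/orP; left; have := hi k.+1 l.+1; lia.
(* Row 4 offers only a weak [hi], so row 5 relies on [d(4,3) = 1 > 0 = d(4,0)] instead. *)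
rewrite dcoefS0; have [n3|n3] := eqVneq n 3%N.
  by rewrite (_ : l.+1 = 3%N) ?n3 ?dcoef_top //; lia.
by apply/orP; right; have := hi 1%N l; lia.
Qed.

Lemma mirror_comirror_lt n : mirror_lt n.+1 /\ comirror_lt n.+1.
Proof.
elim: n => [|n [lo hi]]; first by split=> k l; lia.
by split; [apply: mirror_ltS | apply: comirror_ltS].
Qed.

(** In row [n.+1] the two reflections compose to a shift, [i] to [n - i] to [i + 1], and below the
    middle neither step decreases the coefficient. *)
Lemma dcoef_le_succ n i : (i < n./2)%N -> (dcoef n i <= dcoef n i.+1)%N.
Proof.
case: n => // n lt_in; have [lo hi] := mirror_comirror_lt n.
apply: (@leq_trans (dcoef n.+1 (n - i))); first by apply: comirror_le => //; lia.
by apply: mirror_le => //; lia.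
Qed.

Lemma dcoef_ge_succ n i : (n./2 <= i)%N -> (dcoef n i.+1 <= dcoef n i)%N.
Proof.
case: n => [|n] le_ni; first by rewrite !dcoef0.
have [lt_ni|le_in] := leqP n i; first by rewrite dcoef_oversize.
have [lo hi] := mirror_comirror_lt n.
apply: (@leq_trans (dcoef n.+1 (n - i))); first by apply: mirror_le => //; lia.
by apply: comirror_le => //; lia.
Qed.

Local Close Scope ring_scope.

Theorem theorem1p2 :
  (forall n k : nat, (1 <= n)%N -> (1 <= k)%N -> (k <= n - 1)%N ->
     [/\ (dcoef (2 * n) (2 * n - k) < dcoef (2 * n) k)%N,
         ~ (n = 2 /\ k = 1) -> (dcoef (2 * n) k < dcoef (2 * n) (2 * n - k - 1))%N,
         (dcoef (2 * n + 1) k < dcoef (2 * n + 1) (2 * n - k))%N &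
         (dcoef (2 * n + 1) (2 * n - k) < dcoef (2 * n + 1) (k + 1))%N])
  /\ (dcoef 4 1 = 4 /\ dcoef 4 2 = 4)
  /\ (forall n : nat, (2 <= n)%N -> unimodal (Dpoly n)).
Proof.
split=> [n k n_gt0 k_gt0 le_kn|].
  have := mirror_comirror_lt (2 * n).-1; have := mirror_comirror_lt (2 * n).
  rewrite prednK ?muln_gt0 // -addn1 => -[lo_odd hi_odd] [lo_even hi_even].
  split.
  - by apply: lo_even; lia.
  - by move=> n2; have := hi_even k (2 * n - k - 1)%N; lia.
  - by have := hi_odd k (2 * n - k)%N; lia.
  - by apply: lo_odd; lia.
split; last first.
  move=> n _; exists n./2; split=> i lt_i; rewrite !coef_Dpoly lez_nat.
    exact: dcoef_le_succ.
  exact: dcoef_ge_succ.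
have d21 := dcoef_top 1; have d32 := dcoef_top 2.
have d20 := dcoefS0 1; have d30 := dcoefS0 2;
have := dcoefS 2 0; have := dcoefS 3 0; have := dcoefS 3 1.
rewrite d20 d21 d30 d32 /=; lia.
Qed.
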